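(* Let $a<b$ be real numbers and let $p\ge 0$ be an integer. There are positive constants $C_1$ and $C_{12}^p$ such that for every positive integer $N$, with $h=(b-a)/N$ and uniform partition $x_i=a+ih$ ($0\le i\le N$), every $u\in W^{p+1}_1(a,b)$, and every function $u^R$ that is a (possibly discontinuous) piecewise polynomial of degree at most $p$ on this partition, $$\|u-u^R\|_{L^1(a,b)}\ \ge\ h^{p+1}\left[C_{12}^p\sum_{1\le i\le N-1} h\,\sqrt{Q(D_i^0,D_i^1,\dots,D_i^p)}\;-\;C_1\,|u|_{W^{p+1}_1(a,b)}\right],$$ where the numbers $D_i^k$ are the scaled derivative jumps of $u^R$ at $x_i$ and $Q$ is the quadratic form, both defined in the context. The constants $C_1$ and $C_{12}^p$ are independent of $h$, $u$ and $u^R$.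
   Context: Fix an integer $p\ge 0$ and let $\mathcal P$ be the space of real polynomials in one variable of degree at most $p$. For the uniform partition $a=x_0<x_1<\dots<x_N=b$ with $x_{i+1}-x_i=h=(b-a)/N$, let $\mathcal P_h$ be the space of functions whose restriction to each open cell $(x_i,x_{i+1})$ is a polynomial of degree at most $p$ (no continuity is required at the nodes). For $u^R\in\mathcal P_h$, $1\le i\le N-1$ and $0\le k\le p$, define the one-sided derivative values $$M_i^k=\frac{d^k}{dx^k}u^R(x_i^+),\qquad L_i^k=\frac{d^k}{dx^k}u^R(x_i^-),$$ the jumps $J_i^k=M_i^k-L_i^k$, and the scaled jumps $$D_i^k=J_i^k/h^{p+1-k}.$$ In $D^k$, $D_i^k$, etc., the superscript $k$ is an index, not a power; likewise the superscript $p$ in $C_{12}^p$ is an index. For real numbers $D^0,D^1,\dots,D^p$ define $$Q(D^0,D^1,\dots,D^p)=\min_{\hat v\in\mathcal P}\left(\left\|\hat v+\frac12\sum_{k=0}^p\frac{D^k}{k!}\xi^k\right\|^2_{L^2(-\frac12,0)}+\left\|\hat v-\frac12\sum_{k=0}^p\frac{D^k}{k!}\xi^k\right\|^2_{L^2(0,\frac12)}\right),$$ where $\xi$ is the variable of the polynomials. $W^{p+1}_1(a,b)$ is the standard Sobolev space of functions with integrable (weak) derivatives up to order $p+1$, and $|u|_{W^{p+1}_1(a,b)}$ is its seminorm, i.e. the $L^1(a,b)$ norm of the derivative of $u$ of order $p+1$. *)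

(* Defs.v *)
From HB Require Import structures.
From mathcomp Require Import all_boot all_order all_algebra.
From mathcomp Require Import all_classical all_reals all_analysis.
From mathcomp Require Import ring.
Set Implicit Arguments.
Unset Strict Implicit.
Unset Printing Implicit Defensive.
Import Order.TTheory GRing.Theory Num.Theory.
Import numFieldNormedType.Exports.
Local Open Scope classical_set_scope.
Local Open Scope ring_scope.

Definition LpNorm (R : realType) (q c d : R) (f : R -> R) : R :=
  fine ('N[lebesgue_measure]_(q%:E)[EFin \o (f \_ `]c, d[)])%E.

(* C_c^oo(]a, b[), as functions on the whole line *)
Definition test_fun (R : realType) (a b : R) (phi : R -> R) : Prop :=
  [/\ forall (n : nat) (x : R), derivable (derive1n n phi) x 1,
      compact (closure [set x | phi x != 0]) &
      closure [set x | phi x != 0] `<=` `]a, b[ ].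

(* g is an integrable weak derivative of order k of u on ]a, b[ ;
   only the values of u and g on ]a, b[ matter, and g is determined almost
   everywhere there *)
Definition is_weak_deriv (R : realType) (a b : R) (k : nat) (u g : R -> R)
    : Prop :=
  lebesgue_measure.-integrable `]a, b[ (EFin \o g) /\
  forall phi : R -> R, test_fun a b phi ->
    \int[lebesgue_measure]_(x in `]a, b[) (u x * derive1n k phi x) =
    (-1) ^+ k * \int[lebesgue_measure]_(x in `]a, b[) (g x * phi x).

(* W^m_1(a, b) *)
Definition sobolevW1 (R : realType) (a b : R) (m : nat) (u : R -> R) : Prop :=
  lebesgue_measure.-integrable `]a, b[ (EFin \o u) /\
  forall k : nat, (k <= m)%N -> exists g : R -> R, is_weak_deriv a b k u g.

(* a chosen representative of the weak derivative; 0 when there is none *)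
Definition weak_deriv (R : realType) (a b : R) (k : nat) (u : R -> R)
    : R -> R :=
  xget (fun=> 0) [set g | is_weak_deriv a b k u g].

Definition sobolev_seminorm (R : realType) (a b : R) (m : nat) (u : R -> R)
    : R :=
  LpNorm 1 a b (weak_deriv a b m u).

Definition mesh (R : realType) (a b : R) (N : nat) : R := (b - a) / N%:R.

Definition node (R : realType) (a b : R) (N i : nat) : R :=
  a + i%:R * mesh a b N.

(* {poly R} has size = degree + 1; the values of w at the nodes are free *)
Definition piecewise_poly (R : realType) (a b : R) (N p : nat) (w : R -> R)
    : Prop :=
  forall i : nat, (i < N)%N -> exists2 v : {poly R}, (size v <= p.+1)%N &
    forall x : R, x \in `]node a b N i, node a b N i.+1[ -> w x = v.[x].

Definition Mval (R : realType) (w : R -> R) (x : R) (k : nat) : R :=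
  lim (derive1n k w @ x^'+).

Definition Lval (R : realType) (w : R -> R) (x : R) (k : nat) : R :=
  lim (derive1n k w @ x^'-).

Definition jump (R : realType) (w : R -> R) (x : R) (k : nat) : R :=
  Mval w x k - Lval w x k.

(* meant for k <= p; the subtraction is truncated *)
Definition scaled_jump (R : realType) (p : nat) (h : R) (w : R -> R) (x : R)
    (k : nat) : R :=
  jump w x k / h ^+ (p.+1 - k).

Definition half_jump (R : realType) (p : nat) (D : 'I_p.+1 -> R) (xi : R) : R :=
  2^-1 * \sum_(k < p.+1) D k / (k`!)%:R * xi ^+ k.

Definition Qobj (R : realType) (p : nat) (D : 'I_p.+1 -> R) (v : {poly R})
    : R :=
  LpNorm 2 (- 2^-1) 0 (fun xi => v.[xi] + half_jump D xi) ^+ 2 +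
  LpNorm 2 0 2^-1 (fun xi => v.[xi] - half_jump D xi) ^+ 2.

(* the infimum is attained: see Q_attained *)
Definition Q (R : realType) (p : nat) (D : 'I_p.+1 -> R) : R :=
  inf [set Qobj D v | v in [set v : {poly R} | (size v <= p.+1)%N]].

Definition integ_poly (R : realType) (c d : R) (P : {poly R}) : R :=
  \int[lebesgue_measure]_(x in `]c, d[) P.[x].

Lemma integrable_horner (R : realType) (c d : R) (P : {poly R}) :
  lebesgue_measure.-integrable `]c, d[ (EFin \o horner P).
Proof.
apply: (@integrableS _ _ _ lebesgue_measure `[c, d]) => //.
  exact: subset_itv_oo_cc.
apply: continuous_compact_integrable; first exact: segment_compact.
by apply: continuous_subspaceT => x; exact: continuous_horner.
Qed.

Lemma LpNorm2_poly (R : realType) (c d : R) (P : {poly R}) :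
  LpNorm 2 c d (horner P) ^+ 2 = integ_poly c d (P * P).
Proof.
rewrite /LpNorm -powR_mulrn ?fine_ge0 ?Lnorm_ge0//.
rewrite -fine_poweR poweR_Lnorm// /integ_poly /Rintegral.
rewrite [in RHS]integral_mkcond; congr fine; apply: eq_integral => x _ /=.
rewrite !patchE; case: ifPn => _ /=.
  by rewrite powR_mulrn// hornerM -expr2 real_normK// num_real.
by rewrite normr0 powR0// pnatr_eq0.
Qed.

Lemma integ_polyD (R : realType) (c d : R) (P S : {poly R}) :
  integ_poly c d (P + S) = integ_poly c d P + integ_poly c d S.
Proof.
rewrite /integ_poly -RintegralD//; try exact: integrable_horner.
by apply: eq_Rintegral => x _; rewrite hornerD.
Qed.

Lemma integ_polyZ (R : realType) (c d t : R) (P : {poly R}) :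
  integ_poly c d (t *: P) = t * integ_poly c d P.
Proof.
rewrite /integ_poly -RintegralZl//; try exact: integrable_horner.
by apply: eq_Rintegral => x _; rewrite hornerZ.
Qed.

Lemma integ_poly_sq_ge0 (R : realType) (c d : R) (P : {poly R}) :
  0 <= integ_poly c d (P * P).
Proof.
by apply: Rintegral_ge0 => x _; rewrite hornerM -expr2 sqr_ge0.
Qed.

Lemma integ_poly_sq_eq0 (R : realType) (c d : R) (P : {poly R}) :
  c < d -> integ_poly c d (P * P) = 0 -> P = 0.
Proof.
move=> cd I0; apply/eqP/negPn/negP => P0.
have iP := integrable_horner c d (P * P).
have cR : countable [set x | root P x].
  apply: finite_set_countable; apply: contrapT.
  move=> /infiniteP/pcard_leP/injfunPex[/= q q_fun q_inj].
  have := @max_poly_roots R P (mkseq q (size P)) P0.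
  rewrite size_mkseq ltnn => H; apply/notF/H.
    by apply/allP => x /mapP[n _ ->]; exact: q_fun.
  by apply/mkseq_uniqP => m n _ _ /q_inj; apply; rewrite inE.
have : ae_eq (@lebesgue_measure R) `]c, d[%classic (EFin \o horner (P * P)) (cst 0%E).
  apply/ae_eq_integral_abs => //; first exact: measurable_int iP.
  transitivity (\int[lebesgue_measure]_(x in `]c, d[) ((P * P).[x])%:E)%E.
    apply: eq_integral => x _ /=.
    by rewrite hornerM -expr2 ger0_norm ?sqr_ge0.
  rewrite -[LHS]fineK; last exact: integrable_fin_num.
  by congr EFin; exact: I0.
move=> [A [mA A0 sA]].
have : (lebesgue_measure `]c, d[%classic <=
        lebesgue_measure (A `|` [set x | root P x]))%E.
  apply: le_measure; rewrite ?inE//.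
    by apply: measurableU => //; exact: countable_measurable.
  move=> x cdx; have [rx|rx] := boolP (root P x); [by right|left].
  apply: sA => /= /(_ cdx) [] /eqP; rewrite hornerM mulf_eq0 orbb.
  by apply/negP.
have mR : measurable [set x | root P x] by exact: countable_measurable.
have -> : lebesgue_measure (A `|` [set x | root P x]) = 0%E.
  apply/eqP; rewrite eq_le measure_ge0 andbT.
  apply: (le_trans (measureU2 _ _ _)) => //.
  rewrite [X in (_ + X <= _)%E](_ : _ = 0%E) ?adde0; first by rewrite -A0.
  exact: countable_lebesgue_measure0.
by rewrite lebesgue_measure_itv/= lte_fin cd -EFinB lee_fin subr_le0 leNgt cd.
Qed.

Definition half_jump_poly (R : realType) (p : nat) (D : 'I_p.+1 -> R)
    : {poly R} :=
  2^-1 *: \sum_(k < p.+1) (D k / (k`!)%:R) *: 'X^k.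

Lemma half_jump_polyE (R : realType) (p : nat) (D : 'I_p.+1 -> R) (x : R) :
  (half_jump_poly D).[x] = half_jump D x.
Proof.
rewrite /half_jump_poly /half_jump hornerZ horner_sum; congr (_ * _).
by apply: eq_bigr => k _; rewrite hornerZ hornerXn.
Qed.

Lemma QobjE (R : realType) (p : nat) (D : 'I_p.+1 -> R) (v : {poly R}) :
  let G := half_jump_poly D in
  Qobj D v = integ_poly (- 2^-1) 0 ((v + G) * (v + G)) +
             integ_poly 0 2^-1 ((v - G) * (v - G)).
Proof.
move=> G; rewrite -!LpNorm2_poly /Qobj.
congr (LpNorm _ _ _ _ ^+ 2 + LpNorm _ _ _ _ ^+ 2); apply/funext => x.
  by rewrite hornerD half_jump_polyE.
by rewrite hornerD hornerN half_jump_polyE.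
Qed.

Lemma Qobj_minimizer (R : realType) (p : nat) (D : 'I_p.+1 -> R) :
  exists2 v : {poly R}, (size v <= p.+1)%N &
    forall w : {poly R}, (size w <= p.+1)%N -> Qobj D v <= Qobj D w.
Proof.
pose G := half_jump_poly D.
pose I1 := @integ_poly R (- 2^-1) 0; pose I2 := @integ_poly R 0 2^-1.
pose B (v w : {poly R}) := I1 (v * w) + I2 (v * w).
pose l (w : {poly R}) := I1 (G * w) - I2 (G * w).
have BZl t v w : B (t *: v) w = t * B v w.
  by rewrite /B -!scalerAl /I1 /I2 !integ_polyZ mulrDr.
have BDl v v' w : B (v + v') w = B v w + B v' w.
  by rewrite /B !mulrDl /I1 /I2 !integ_polyD addrACA.
have BC v w : B v w = B w v by rewrite /B mulrC.
have lZ t w : l (t *: w) = t * l w.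
  by rewrite /l -!scalerAr /I1 /I2 !integ_polyZ mulrBr.
have lD w w' : l (w + w') = l w + l w'.
  by rewrite /l !mulrDr /I1 /I2 !integ_polyD opprD addrACA.
have I0 c d : integ_poly c d (0 : {poly R}) = 0.
  by rewrite -(scale0r 0) integ_polyZ mul0r.
have B0 w : B 0 w = 0 by rewrite /B mul0r /I1 /I2 !I0 addr0.
have l0 : l 0 = 0 by rewrite /l mulr0 /I1 /I2 !I0 subr0.
have Bge0 v : 0 <= B v v by rewrite addr_ge0// integ_poly_sq_ge0.
have Beq0 v : B v v = 0 -> v = 0.
  move=> /eqP; rewrite paddr_eq0 ?integ_poly_sq_ge0// => /andP[_ /eqP].
  by apply: integ_poly_sq_eq0; rewrite invr_gt0.
pose e (i : 'I_p.+1) : {poly R} := 'X^i.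
have Bsum (x : 'rV[R]_p.+1) w :
    B (\sum_i x 0 i *: e i) w = \sum_i x 0 i * B (e i) w.
  rewrite (big_morph (B^~ w) (fun v v' => BDl v v' w) (B0 w)).
  by apply: eq_bigr => i _; rewrite BZl.
have polyE (w : {poly R}) : (size w <= p.+1)%N ->
    w = \sum_i (\row_j w`_j : 'rV[R]_p.+1) 0 i *: e i.
  move=> sw; under eq_bigr => j _ do rewrite mxE.
  rewrite -(poly_def p.+1 (fun i => w`_i)); apply/polyP => i.
  by rewrite coef_poly; case: ltnP => // ip; rewrite nth_default// (leq_trans sw).
pose A : 'M[R]_p.+1 := \matrix_(i, j) B (e i) (e j).
have uA : A \in unitmx.
  rewrite -row_free_unit -kermx_eq0; apply/rowV0P => x /sub_kermxP xA0.
  have : B (\sum_i x 0 i *: e i) (\sum_i x 0 i *: e i) = 0.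
    rewrite Bsum big1// => j _; rewrite BC Bsum.
    have := congr1 (fun m : 'rV[R]_p.+1 => m 0 j) xA0; rewrite !mxE.
    by under eq_bigr => k _ do rewrite mxE; move=> ->; rewrite mulr0.
  move=> /Beq0 x0; apply/rowP => i; rewrite mxE.
  have := congr1 (fun q : {poly R} => q`_i) x0; rewrite coef0 coef_sum.
  rewrite (bigD1 i)//= big1 ?addr0 => [|j ji].
    by rewrite coefZ coefXn eqxx mulr1.
  by rewrite coefZ coefXn [_ == _](negbTE _) ?mulr0// eq_sym.
pose x := (\row_j - l (e j) : 'rV[R]_p.+1) *m invmx A.
pose v := \sum_i x 0 i *: e i.
have sv : (size v <= p.+1)%N.
  rewrite (leq_trans (size_sum _ _ _))//; apply/bigmax_leqP => i _.
  by rewrite (leq_trans (size_scale_leq _ _))// size_polyXn.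
have Bve j : B v (e j) = - l (e j).
  have xA : x *m A = \row_j - l (e j) by rewrite /x mulmxKV.
  have := congr1 (fun m : 'rV[R]_p.+1 => m 0 j) xA.
  rewrite /= [LHS]mxE [RHS]mxE => <-.
  by rewrite Bsum; apply: eq_bigr => k _; rewrite [A _ _]mxE.
have Bv (w : {poly R}) : (size w <= p.+1)%N -> B v w = - l w.
  move=> /polyE ->; rewrite BC Bsum (big_morph l lD l0) -sumrN.
  by apply: eq_bigr => i _; rewrite lZ BC Bve mulrN.
exists v => // w sw; rewrite !QobjE -/G -/I1 -/I2.
pose z := w - v.
have wE : w = v + z by rewrite /z addrC subrK.
have sz : (size z <= p.+1)%N.
  by rewrite (leq_trans (size_polyD _ _))// size_polyN geq_max sw.
have E1 : (w + G) * (w + G) =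
    (v + G) * (v + G) + (2 *: (v * z) + (2 *: (G * z) + z * z)).
  by rewrite wE !scaler_nat; ring.
have E2 : (w - G) * (w - G) =
    (v - G) * (v - G) + (2 *: (v * z) + ((- 2) *: (G * z) + z * z)).
  by rewrite wE scaleNr !scaler_nat; ring.
rewrite E1 E2 /I1 /I2 !integ_polyD !integ_polyZ -/I1 -/I2.
rewrite -subr_ge0 [X in 0 <= X](_ : _ = 2 * (B v z + l z) + B z z).
  by rewrite Bv// addNr mulr0 add0r.
rewrite /B /l; ring.
Qed.

Lemma Q_attained (R : realType) (p : nat) (D : 'I_p.+1 -> R) :
  exists2 v : {poly R}, (size v <= p.+1)%N &
    Q D = Qobj D v /\
    forall w : {poly R}, (size w <= p.+1)%N -> Q D <= Qobj D w.
Proof.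
have [v sv vmin] := Qobj_minimizer D.
have QE : Q D = Qobj D v.
  apply/eqP; rewrite eq_le; apply/andP; split.
    apply: ge_inf; last by exists v.
    by exists (Qobj D v) => _ [w sw <-]; exact: vmin.
  apply: lb_le_inf; first by exists (Qobj D v), v.
  by move=> _ [w sw <-]; exact: vmin.
by exists v => //; split=> // w sw; rewrite QE; exact: vmin.
Qed.

(* Main.v *)
(** The proof is by duality. Testing the weak derivative of order p+1 against
    psi((x - x_i)/h), with psi smooth and supported in [-1/4, 1/4], bounds the
    integral of u psi^((p+1))((x - x_i)/h)/h^(p+1) by the local L^1 norm of
    u^((p+1)). For u^R in place of u, repeated integration by parts on either
    side of x_i leaves only the boundary terms at x_i, a combination of the
    jumps of u^R with coefficients the derivatives of psi at 0. Choosing psi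
    with psi^((j))(0) = 1 if j = p - m and 0 otherwise (j <= p) isolates the
    m-th jump, whence
      h |D_i^m| <= K (h^-(p+1) ||u - u^R||_(L^1(I_i)) + |u|_(W^(p+1)_1(I_i)))
    on the disjoint intervals I_i of length h centered at the x_i. Taking v = 0
    in the definition of Q gives sqrt Q(D) <= sum_m |D^m|, and it remains to sum
    over i and m. *)

Require Import Defs.
From HB Require Import structures.
From mathcomp Require Import all_boot all_order all_algebra.
From mathcomp Require Import all_classical all_reals all_analysis.
From mathcomp Require Import ring lra.
Set Implicit Arguments.
Unset Strict Implicit.
Unset Printing Implicit Defensive.
Import Order.TTheory GRing.Theory Num.Theory.
Import numFieldNormedType.Exports.
Local Open Scope classical_set_scope.
Local Open Scope ring_scope.

(** * Smooth functions: closure properties and iterated derivatives *)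

Definition smooth (R : realType) (f : R -> R) : Prop :=
  forall (n : nat) (x : R), derivable (derive1n n f) x 1.

Lemma smooth_derivable (R : realType) (f : R -> R) (x : R) :
  smooth f -> derivable f x 1.
Proof. by move=> /(_ 0%N x). Qed.

Lemma smooth_derive1 (R : realType) (f : R -> R) : smooth f -> smooth (derive1 f).
Proof. by move=> sf n x; rewrite -derive1Sn; exact: sf. Qed.

(** Induction on the order with the function left general: [derive1Sn] peels off the innermost
    derivative, which stays in the class. Exhibiting a stable class replaces a formula for the n-th
    derivative. *)
Lemma smooth_coind (R : realType) (S : (R -> R) -> Prop) :
  (forall f, S f -> (forall x, derivable f x 1) /\ S (derive1 f)) ->
  forall f, S f -> smooth f.
Proof.
move=> H f Sf n; elim: n f Sf => [|n IH] f /H[df Sf'] x; first exact: df.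
by rewrite derive1Sn; exact: IH.
Qed.

(** When a candidate for every derivative can be written down, checking each single differentiation
    yields smoothness and the values together. *)
Lemma derive1n_family (R : realType) (F : nat -> R -> R) :
  (forall n x, is_derive x (1 : R) (F n) (F n.+1 x)) ->
  smooth (F 0%N) /\ forall n, derive1n n (F 0%N) = F n.
Proof.
move=> dF; have E n : derive1n n (F 0%N) = F n.
  elim: n => [//|n IH]; rewrite derive1nS IH; apply/funext => x.
  by rewrite derive1E; apply: derive_val.
by split=> // n x; rewrite E; have [] := dF n x.
Qed.

(** The outer function of [Smooth_comp] is smooth outright rather than an expression: its derivative
    is then again an admissible outer function, as the chain rule requires. *)
Inductive smooth_expr (R : realType) : (R -> R) -> Prop :=
| Smooth_atom f of smooth f : smooth_expr f
| Smooth_add f g of smooth_expr f & smooth_expr g :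
    smooth_expr (fun x => f x + g x)
| Smooth_mul f g of smooth_expr f & smooth_expr g :
    smooth_expr (fun x => f x * g x)
| Smooth_comp f g of smooth f & smooth_expr g :
    smooth_expr (fun x => f (g x)).

(* A class of functions closed under differentiation consists of smooth
   functions; this one contains the derivatives of its members because of the
   sum, product and chain rules. *)
Lemma smooth_exprP (R : realType) (f : R -> R) : smooth_expr f -> smooth f.
Proof.
apply: (@smooth_coind R (@smooth_expr R)) => {}f.
elim=> {f} [f sf|f g _ [df ef] _ [dg eg]|f g Sf [df ef] Sg [dg eg]|
  f g sf Sg [dg eg]].
- split; first by move=> x; exact: smooth_derivable.
  by apply: Smooth_atom; exact: smooth_derive1.
- split; first by move=> x; apply: derivableD; [exact: df|exact: dg].
  rewrite (_ : derive1 _ = fun x => derive1 f x + derive1 g x).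
    exact: Smooth_add.
  by apply/funext => x; rewrite !derive1E deriveD.
- split; first by move=> x; apply: derivableM; [exact: df|exact: dg].
  rewrite (_ : derive1 _ = fun x => f x * derive1 g x + g x * derive1 f x).
    by apply: Smooth_add; exact: Smooth_mul.
  by apply/funext => x; rewrite !derive1E deriveM.
- have cfg x : is_derive x (1 : R) (fun x => f (g x))
      (derive1 f (g x) * derive1 g x).
    apply: (@is_derive1_comp R f g x); rewrite derive1E; apply: DeriveDef => //.
    exact: smooth_derivable.
  split; first by move=> x; have [] := cfg x.
  rewrite (_ : derive1 _ = fun x => derive1 f (g x) * derive1 g x).
    apply: Smooth_mul => //; apply: Smooth_comp => //; exact: smooth_derive1.
  by apply/funext => x; rewrite derive1E; apply: derive_val.
Qed.

Lemma smoothD (R : realType) (f g : R -> R) :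
  smooth f -> smooth g -> smooth (fun x => f x + g x).
Proof. by move=> *; apply: smooth_exprP; apply: Smooth_add; exact: Smooth_atom. Qed.

Lemma smoothM (R : realType) (f g : R -> R) :
  smooth f -> smooth g -> smooth (fun x => f x * g x).
Proof. by move=> *; apply: smooth_exprP; apply: Smooth_mul; exact: Smooth_atom. Qed.

Lemma smooth_comp (R : realType) (f g : R -> R) :
  smooth f -> smooth g -> smooth (fun x => f (g x)).
Proof.
by move=> *; apply: smooth_exprP; apply: Smooth_comp => //; exact: Smooth_atom.
Qed.

Lemma smooth_horner (R : realType) (P : {poly R}) : smooth (horner P).
Proof.
apply: (@smooth_coind R (fun f => exists P : {poly R}, f = horner P)).
  move=> _ [S ->]; split; first by move=> x; exact: derivable_horner.
  by exists S^`(); rewrite derivE.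
by exists P.
Qed.

Lemma derive1n_horner (R : realType) (P : {poly R}) (n : nat) :
  derive1n n (horner P) = horner P^`(n).
Proof.
elim: n => [|n IH]; first by rewrite derivn0.
by rewrite derive1nS IH derivnS derivE.
Qed.

Lemma derive1nD (R : realType) (f g : R -> R) (n : nat) :
  smooth f -> smooth g ->
  derive1n n (fun x => f x + g x) = fun x => derive1n n f x + derive1n n g x.
Proof.
move=> sf sg.
have [|_ -> //] := @derive1n_family R (fun n x => derive1n n f x + derive1n n g x).
by move=> {}n x; rewrite !derive1nS !derive1E; apply: is_deriveD; exact: DeriveDef.
Qed.

Lemma derive1nZ (R : realType) (c : R) (f : R -> R) (n : nat) :
  smooth f -> derive1n n (fun x => c * f x) = fun x => c * derive1n n f x.
Proof.
move=> sf.
have [|_ -> //] := @derive1n_family R (fun n x => c * derive1n n f x).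
by move=> {}n x; rewrite derive1nS derive1E; apply: is_deriveZ; exact: DeriveDef.
Qed.

Lemma smoothZ (R : realType) (c : R) (f : R -> R) :
  smooth f -> smooth (fun x => c * f x).
Proof.
move=> sf; apply: smoothM => //.
by rewrite -[fun=> c]hornerC_ext; exact: smooth_horner.
Qed.

Lemma derive1n_affine (R : realType) (c l : R) (f : R -> R) (n : nat) :
  smooth f ->
  derive1n n (fun x => f ((x - c) / l)) =
  fun x => l ^- n * derive1n n f ((x - c) / l).
Proof.
move=> sf.
have [|_] := @derive1n_family R (fun n x => l ^- n * derive1n n f ((x - c) / l)).
  move=> {}n x.
  have -> : l ^- n.+1 * derive1n n.+1 f ((x - c) / l) =
      l ^- n *: (derive1n n.+1 f ((x - c) / l) * l^-1).
    by rewrite exprS invfM /GRing.scale /=; ring.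
  apply: is_deriveZ.
  apply: (@is_derive1_comp R (derive1n n f) (fun x => (x - c) / l) x).
    by rewrite derive1nS derive1E; exact: DeriveDef.
  (* Writing the affine map as a polynomial lets its derivative be computed algebraically. *)
  rewrite (_ : (fun _ => _) = horner ((l^-1)%:P * ('X - c%:P))); last first.
    by apply/funext => y; rewrite !hornerE mulrC.
  have := is_derive_poly ((l^-1)%:P * ('X - c%:P)) x.
  by rewrite derivM derivC derivXsubC mul0r add0r mulr1 hornerC.
by rewrite expr0 invr1; under eq_fun do rewrite mul1r; move=> ->.
Qed.

Lemma smooth_affine (R : realType) (c l : R) (f : R -> R) :
  smooth f -> smooth (fun x => f ((x - c) / l)).
Proof.
move=> sf; apply: smooth_comp => //.
have -> : (fun x => (x - c) / l) = horner ((l^-1)%:P * ('X - c%:P)).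
  by apply/funext => x; rewrite !hornerE mulrC.
exact: smooth_horner.
Qed.

(** Openness carries the equality through the induction: it holds near each point, and a derivative
    sees only nearby values. *)
Lemma derive1n_eq_open (R : realType) (f g : R -> R) (A : set R) (n : nat) :
  open A -> {in A, f =1 g} -> {in A, derive1n n f =1 derive1n n g}.
Proof.
move=> oA; elim: n => [//|n IH] fg x Ax.
rewrite !derive1nS !derive1E; apply: near_eq_derive.
rewrite inE in Ax.
apply: filterS (open_nbhs_nbhs (conj oA Ax)) => y Ay.
by apply: IH => //; rewrite inE.
Qed.

Lemma smooth_continuous (R : realType) (f : R -> R) : smooth f -> continuous f.
Proof.
move=> sf x; apply/differentiable_continuous/derivable1_diffP.
exact: smooth_derivable.
Qed.

Lemma smooth_derive1n (R : realType) (f : R -> R) n :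
  smooth f -> smooth (derive1n n f).
Proof.
by move=> sf; elim: n => [//|n IH]; rewrite derive1nS; exact: smooth_derive1.
Qed.

(* Jets of x^n f at 0, by induction on n, since
   (x^(n+1) f)' = x^n ((n+1) f + x f'). *)
Lemma derive1n_Xn_mul (R : realType) (f : R -> R) (n : nat) : smooth f ->
  (forall j, (j < n)%N -> derive1n j (fun x => x ^+ n * f x) 0 = 0) /\
  derive1n n (fun x => x ^+ n * f x) 0 = n`!%:R * f 0.
Proof.
elim: n f => [|n IH] f sf.
  by split=> //; rewrite /derive1n /= expr0.
pose g x := n.+1%:R * f x + x * derive1 f x.
have sid : smooth (fun x : R => x).
  by rewrite (_ : (fun _ => _) = horner 'X);
     [exact: smooth_horner|apply/funext => x; rewrite hornerX].
have sg : smooth g.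
  by apply: smoothD; [exact: smoothZ|apply: smoothM => //; exact: smooth_derive1].
have dE : derive1 (fun x => x ^+ n.+1 * f x) = fun x => x ^+ n * g x.
  apply/funext => x; rewrite derive1E (@deriveM R R (fun x => x ^+ n.+1) f x 1);
    [|exact: exprn_derivable|exact: smooth_derivable].
  rewrite -!derive1E (exp_derive1 n.+1 x) /g /GRing.scale /=.
  by rewrite exprS; ring.
have [g0 gn] := IH _ sg; split.
  case=> [_|j jn]; first by rewrite /derive1n /= expr0n mul0r.
  by rewrite derive1Sn dE g0.
by rewrite derive1Sn dE gn /g mul0r addr0 mulrA -natrM factS mulnC.
Qed.

(** * Flat functions, smooth bumps and prescribed jets at 0 *)

(** The function P(1/x) exp(-1/x), extended by 0. Keeping the polynomial [P] as a parameter makes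
    the family stable under differentiation; [P] = 1 is the classical smooth non-analytic
    function. *)
Definition flat (R : realType) (P : {poly R}) (x : R) : R :=
  if 0 < x then P.[x^-1] * expR (- x^-1) else 0.

Lemma horner_le_pow (R : realType) (P : {poly R}) (y : R) : 1 <= y ->
  `|P.[y]| <= (\sum_(i < size P) `|P`_i|) * y ^+ size P.
Proof.
move=> y1; have y0 : 0 <= y by exact: le_trans y1.
rewrite horner_coef (le_trans (ler_norm_sum _ _ _))// mulr_suml.
apply: ler_sum => i _; rewrite normrM normrX (ger0_norm y0) ler_wpM2l//.
by rewrite ler_weXn2l// ltnW.
Qed.

(** With y = 1/x >= 1 and n = [size P], the polynomial is at most a constant times y^n, whereas exp
    y >= y^(n+1) / (n+1)!. The quotient leaves one factor 1/y = x. *)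
Lemma flat_le (R : realType) (P : {poly R}) :
  exists2 C : R, 0 < C & forall x, `|x| <= 1 -> `|flat P x| <= C * `|x|.
Proof.
pose n := size P; pose S := \sum_(i < size P) `|P`_i|.
have S0 : 0 <= S by apply: sumr_ge0.
(* Adding 1 keeps the constant positive even when [P] is 0. *)
exists (S * n.+1`!%:R + 1) => [|x x1].
  by rewrite ltr_wpDl// mulr_ge0.
rewrite /flat; case: ifPn => [x0|_]; last first.
  by rewrite normr0 mulr_ge0// addr_ge0// mulr_ge0.
rewrite gtr0_norm// in x1 *; set y := x^-1.
have y1 : 1 <= y by rewrite invf_ge1.
have y0 : 0 < y by exact: lt_le_trans y1.
have ey : y ^+ n.+1 / n.+1`!%:R <= expR y.
  by apply: le_trans (expR_ge1Dxn n (ltW y0)); rewrite lerDr.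
rewrite normrM (ger0_norm (expR_ge0 _)) expRN.
apply: (@le_trans _ _ (S * y ^+ n * (n.+1`!%:R / y ^+ n.+1))).
  apply: ler_pM => //.
    exact: horner_le_pow.
  rewrite -[leRHS]invrK lef_pV2 ?posrE ?expR_gt0//.
    by rewrite invfM invrK mulrC.
  by rewrite invr_gt0 divr_gt0 ?exprn_gt0// ltr0n fact_gt0.
have -> : S * y ^+ n * (n.+1`!%:R / y ^+ n.+1) = S * n.+1`!%:R * x.
  rewrite exprS -[x in RHS]invrK -/y; field.
  by rewrite gt_eqF// gt_eqF// exprn_gt0.
by rewrite ler_wpM2r ?lerDl// ltW.
Qed.

Lemma flat_continuous0 (R : realType) (P : {poly R}) :
  flat P x @[x --> (0 : R)] --> flat P 0.
Proof.
have [C C0 HC] := flat_le P.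
apply/cvgrPdist_le => e e0.
near=> x; rewrite {1}/flat ltxx sub0r normrN.
have x1 : `|x| <= 1 by near: x; exact: (@nbhs0_le _ R).
have xe : `|x| <= e / C by near: x; apply: (@nbhs0_le _ R); exact: divr_gt0.
by rewrite (le_trans (HC _ x1))// mulrC -ler_pdivlMr.
Unshelve. all: by end_near. Qed.

(** For x > 0 the chain rule gives (P(1/x) - P'(1/x)) x^-2 exp(-1/x), again of the shape [flat]; for
    x < 0 the function is locally 0. *)
Lemma is_derive_flat (R : realType) (P : {poly R}) (x : R) :
  is_derive x (1 : R) (flat P) (flat ((P - P^`()) * 'X^2) x).
Proof.
have [x0|x0|->] := ltgtP x 0.
- rewrite [X in is_derive _ _ _ X]/flat ltNge (ltW x0)/=.
  apply: (near_eq_is_derive (f := cst 0)).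
    near=> y; rewrite /flat ltNge (_ : y <= 0)//; near: y.
    by apply: filterS (lt_nbhsl x0) => y /ltW.
- rewrite [X in is_derive _ _ _ X]/flat x0.
  apply: (@near_eq_is_derive R R R (fun y => P.[y^-1] * expR (- y^-1))).
    near=> y; rewrite /flat (_ : 0 < y)//; near: y.
    exact: lt_nbhsr.
  have dV : is_derive x (1 : R) (fun y => y^-1) (- x ^- 2).
    apply: DeriveDef; first by apply: derivableV => //; rewrite gt_eqF.
    rewrite (@deriveV _ _ id)//; last by rewrite gt_eqF.
    by rewrite derive_id /GRing.scale /= mulr1.
  have d1 := @is_derive1_comp R (horner P) _ x _ _ (is_derive_poly P _) dV.
  have d2 := @is_derive1_comp R (@expR R) _ x _ _ (is_derive_expR _)
    (is_deriveN dV).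
  apply: is_derive_eq (is_deriveM d1 d2) _.
  by rewrite !hornerE -exprVn /GRing.scale /=; set e := expR _; ring.
(* At 0 the difference quotient of [flat P] is [flat (P * 'X)], which is continuous there with value
   0. *)
- apply/is_derive1_caratheodory; exists (flat (P * 'X)); split.
  + move=> z; rewrite {2}/flat ltxx !subr0 /flat; case: ifPn => z0.
      by rewrite hornerM hornerX mulrAC mulfVK// gt_eqF.
    by rewrite mul0r.
  + exact: flat_continuous0.
  + by rewrite /flat ltxx.
Unshelve. all: by end_near. Qed.

Lemma smooth_flat (R : realType) (P : {poly R}) : smooth (flat P).
Proof.
have [|//] := @derive1n_family R
  (fun n => flat (iter n (fun S => (S - S^`()) * 'X^2) P)).
by move=> n x; exact: is_derive_flat.
Qed.

(** One factor vanishes left of -r, the other right of r. The divisions by 1 and -1 put both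
    arguments in the shape expected by [smooth_affine]. *)
Definition flat_bump (R : realType) (r x : R) : R :=
  flat 1 ((x - (- r)) / 1) * flat 1 ((x - r) / (- 1)).

Lemma smooth_flat_bump (R : realType) (r : R) : smooth (flat_bump r).
Proof. by apply: smoothM; apply: smooth_affine; exact: smooth_flat. Qed.

Lemma flat_bump_gt0 (R : realType) (r : R) : 0 < r -> 0 < flat_bump r 0.
Proof.
move=> r0; rewrite /flat_bump /flat !sub0r invrN1 mulrN1 divr1 opprK r0 !hornerE.
by rewrite /= mulr1 mulr_gt0 ?expR_gt0.
Qed.

Lemma flat_bump_eq0 (R : realType) (r x : R) : x \notin `[- r, r] -> flat_bump r x = 0.
Proof.
rewrite in_itv /= negb_and -!ltNge /flat_bump /flat invrN1 mulrN1 divr1 opprK opprB.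
move=> /orP[] h; last by rewrite [0 < r - x]ltNge subr_le0 (ltW h) mulr0.
rewrite ltNge -[x + r]opprK opprD oppr_le0 -/(- x - r) subr_ge0.
by rewrite lerNr (ltW h) mul0r.
Qed.

(* Smooth functions supported in [-r, r] realize every jet at 0. *)
Lemma smooth_jet (R : realType) (r : R) (c : nat -> R) (n : nat) : 0 < r ->
  exists f : R -> R, [/\ smooth f, forall x, x \notin `[- r, r] -> f x = 0 &
    forall j, (j < n)%N -> derive1n j f 0 = c j].
Proof.
move=> r0; elim: n => [|n [f [sf f0 fc]]].
  by exists (flat_bump r); split=> //; [exact: smooth_flat_bump|exact: flat_bump_eq0].
(* The jet of [g] vanishes below order n and equals n! times [flat_bump r 0] at order n. Adding [t]
   times [g] thus keeps the orders already matched and corrects order n. *)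
pose t := (c n - derive1n n f 0) / (n`!%:R * flat_bump r 0).
pose g x := x ^+ n * flat_bump r x.
have sg : smooth g.
  apply: smoothM; last exact: smooth_flat_bump.
  by rewrite (_ : (fun _ => _) = horner 'X^n);
    [exact: smooth_horner|apply/funext => x; rewrite hornerXn].
have [gj gn] := derive1n_Xn_mul n (@smooth_flat_bump R r).
exists (fun x => f x + t * g x); split.
- by apply: smoothD => //; exact: smoothZ.
- by move=> x xr; rewrite f0// /g flat_bump_eq0// !mulr0 addr0.
- move=> j; rewrite ltnS leq_eqVlt derive1nD//; last exact: smoothZ.
  rewrite derive1nZ// => /predU1P[->|jn]; last by rewrite fc// gj// mulr0 addr0.
  rewrite gn /t mulfVK ?subrKC//.
  by rewrite mulf_neq0 ?gt_eqF ?flat_bump_gt0// ltr0n fact_gt0.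
Qed.

Lemma derive1n_eq0 (R : realType) (r : R) (f : R -> R) (n : nat) (x : R) :
  (forall x, x \notin `[- r, r] -> f x = 0) ->
  x \notin `[- r, r] -> derive1n n f x = 0.
Proof.
move=> f0 xr; have oA : open (~` `[- r, r]%classic).
  by apply: closed_openC; exact: itv_closed.
(* The zero function is taken as a polynomial so that [derive1n_horner] gives all its
   derivatives. *)
rewrite (derive1n_eq_open (g := horner 0) n oA).
- by rewrite derive1n_horner linear0 horner0.
- by move=> y; rewrite inE /= => /negP yr; rewrite f0// horner0.
- by rewrite inE /=; exact/negP.
Qed.

Lemma smooth_bounded (R : realType) (r : R) (f : R -> R) :
  smooth f -> (forall x, x \notin `[- r, r] -> f x = 0) ->
  exists2 K, 0 < K & forall x, `|f x| <= K.
Proof.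
move=> sf f0.
have : bounded_set [set f x | x in `[- r, r]%classic].
  apply: compact_bounded; apply: continuous_compact; last exact: segment_compact.
  by apply: continuous_subspaceT; exact: smooth_continuous.
move=> /ex_strict_bound_gt0[K K0 HK]; exists K => // x.
have [xr|xr] := boolP (x \in `[- r, r]).
  by apply/ltW/HK; exists x.
by rewrite f0// normr0 ltW.
Qed.

(** * Integrability on the mesh and sums of integrals over disjoint intervals *)

(** Additivity of the integral requires disjoint pieces, so [B] is first replaced by its part
    outside [A]. *)
Lemma integrableU d (T : measurableType d) (R : realType)
    (mu : {measure set T -> \bar R}) (A B : set T) (f : T -> \bar R) :
  measurable A -> measurable B ->
  mu.-integrable A f -> mu.-integrable B f ->
  mu.-integrable (A `|` B) f.
Proof.
move=> mA mB iA iB; have /integrableP[mfA fA] := iA.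
have mD : measurable (B `\` A) by exact: measurableD.
have iD : mu.-integrable (B `\` A) f.
  by apply: integrableS iB => //; exact: subDsetl.
have /integrableP[mfD fD] := iD.
have -> : A `|` B = A `|` (B `\` A) by rewrite setUDr setDv setD0.
rewrite /is_true; apply/integrableP; split; first exact/measurable_funU.
rewrite ge0_integral_setU//.
- exact: lte_add_pinfty.
- apply/measurable_funU => //; split.
    exact: measurable_int (integrable_abse iA).
  exact: measurable_int (integrable_abse iD).
- by apply/disj_setPS => x [Ax []].
Qed.

Lemma integrable_set1 (R : realType) (x : R) (f : R -> \bar R) :
  lebesgue_measure.-integrable [set x] f.
Proof.
apply/integrableP; split; last by rewrite integral_set1.
exact: measurable_fun_set1.
Qed.

Lemma le_node (R : realType) (a b : R) (N : nat) :
  a < b -> {homo node a b N : i j / (i <= j)%N >-> i <= j}.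
Proof.
move=> ab i j ij; rewrite /node lerD2l ler_wpM2r ?ler_nat// /mesh.
by rewrite mulr_ge0 ?subr_ge0 ?invr_ge0// ltW.
Qed.

Lemma node_last (R : realType) (a b : R) (N : nat) : (0 < N)%N -> node a b N N = b.
Proof.
move=> N0; rewrite /node /mesh mulrC mulfVK ?subrKC//.
by rewrite pnatr_eq0 -lt0n.
Qed.

(** Induction on the number of cells, adding one node and one cell at a time. The arbitrary values
    at the nodes are harmless because singletons are null sets. *)
Lemma piecewise_poly_integrable (R : realType) (a b : R) (N p : nat)
    (w : R -> R) : a < b -> (0 < N)%N -> piecewise_poly a b N p w ->
  lebesgue_measure.-integrable `]a, b[ (EFin \o w).
Proof.
move=> ab N0 pw; rewrite -[X in `]a, X[](node_last a b N0).
suff H k : (k <= N)%N -> lebesgue_measure.-integrable `]a, node a b N k[ (EFin \o w).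
  exact: H.
elim: k => [_|k IH kN].
  by rewrite /node mul0r addr0 set_itvoo0; exact: integrable_set0.
have [v _ vE] := pw _ kN.
have iw : lebesgue_measure.-integrable `]node a b N k, node a b N k.+1[ (EFin \o w).
  apply: eq_integrable (integrable_horner _ _ v) => //= x.
  by rewrite inE/= => /vE ->.
have sub : `]a, node a b N k.+1[ `<=` (`]a, node a b N k[ `|` [set node a b N k])
    `|` `]node a b N k, node a b N k.+1[.
  move=> x /=; rewrite !in_itv/= => /andP[ax xk].
  by have [x1|x1|->] := ltgtP x (node a b N k); [left; left|right|left; right];
    rewrite ?ax ?xk.
apply: (@integrableS _ _ _ lebesgue_measure _ _ _ _ _ sub) => //.
  by do !apply: measurableU.
apply: integrableU => //; first exact: measurableU.
apply: integrableU => //; first exact/IH/ltnW.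
exact: integrable_set1.
Qed.

Lemma LpNorm1E (R : realType) (a b : R) (f : R -> R) :
  LpNorm 1 a b f = \int[lebesgue_measure]_(x in `]a, b[) `|f x|.
Proof.
rewrite /LpNorm Lnorm1 /Rintegral [in RHS]integral_mkcond; congr fine.
apply: eq_integral => x _ /=; rewrite !patchE; case: ifPn => //= _.
by rewrite normr0.
Qed.

Lemma Rintegral_support (R : realType) (A B : set R) (f : R -> R) :
  A `<=` B -> (forall x, B x -> ~ A x -> f x = 0) ->
  \int[lebesgue_measure]_(x in B) f x = \int[lebesgue_measure]_(x in A) f x.
Proof.
move=> AB f0; rewrite Rintegral_mkcond [RHS]Rintegral_mkcond.
apply: eq_Rintegral => x _; rewrite !patchE.
case: ifPn => [/set_mem Bx|Bx]; case: ifPn => [/set_mem Ax|Ax] //.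
- by apply: f0 => // /mem_set; exact/negP.
- by move: Bx; rewrite mem_set//; exact: AB.
Qed.

Lemma Rintegral_subset (R : realType) (A B : set R) (f : R -> R) :
  measurable A -> measurable B -> A `<=` B -> (forall x, 0 <= f x) ->
  lebesgue_measure.-integrable B (EFin \o f) ->
  \int[lebesgue_measure]_(x in A) f x <= \int[lebesgue_measure]_(x in B) f x.
Proof.
move=> mA mB AB f0 fi.
have fA := @integrableS _ _ R lebesgue_measure _ _ _ mB mA AB fi.
apply: fine_le; [exact: integrable_fin_num..|].
apply: ge0_subset_integral => //; first exact: measurable_int fi.
by move=> x _; rewrite lee_fin.
Qed.

Lemma sum_Rintegral_le (R : realType) (a b h : R) (t : nat -> R) (N : nat)
    (f : R -> R) : 0 <= h ->
  (forall x, 0 <= f x) ->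
  lebesgue_measure.-integrable `]a, b[ (EFin \o f) ->
  (forall i, (0 < i < N)%N -> [/\ a <= t i, t i + h <= t i.+1 & t i + h <= b]) ->
  \sum_(1 <= i < N) \int[lebesgue_measure]_(x in `]t i, t i + h[) f x <=
  \int[lebesgue_measure]_(x in `]a, b[) f x.
Proof.
move=> h0 f0 fi ht.
have [N1|N1] := leqP N 1.
  by rewrite big_geq//; apply: Rintegral_ge0 => x _.
(* The partial sum is compared with the integral up to the right end of its last interval, so that
   the next interval is disjoint from the region already used. *)
suff H k : (0 < k < N)%N ->
    \sum_(1 <= i < k.+1) \int[lebesgue_measure]_(x in `]t i, t i + h[) f x <=
    \int[lebesgue_measure]_(x in `]a, t k + h[) f x.
  have kN : (0 < N.-1 < N)%N by case: N N1 {ht H} => [|[|]] //=.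
  have := H _ kN; rewrite prednK ?(ltnW N1)// => /le_trans; apply.
  apply: Rintegral_subset => //; apply: subset_itvl; rewrite bnd_simp.
  by have [] := ht _ kN.
elim: k => [//|[|k] IH] kN; have [h1 h2 h3] := ht _ kN.
  rewrite big_nat1; apply: Rintegral_subset => //.
    by apply: subset_itvr; rewrite bnd_simp.
  apply: (@integrableS _ _ R lebesgue_measure) fi => //.
  by apply: subset_itvl; rewrite bnd_simp.
have kN' : (0 < k.+1 < N)%N by exact: ltnW.
have [g1 g2 g3] := ht _ kN'.
rewrite big_nat_recr//=.
apply: le_trans (lerD (IH kN') (lexx _)) _.
have sub : `]a, t k.+1 + h[ `|` `]t k.+2, t k.+2 + h[ `<=` `]a, t k.+2 + h[.
  move=> x [] /=; rewrite !in_itv/= => /andP[x1 x2]; apply/andP; split => //.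
  - by rewrite (lt_le_trans x2)// (le_trans g2)// lerDl.
  - exact: le_lt_trans x1.
have i2 : lebesgue_measure.-integrable `]a, t k.+2 + h[ (EFin \o f).
  apply: (@integrableS _ _ R lebesgue_measure) fi => //.
  by apply: subset_itvl; rewrite bnd_simp.
rewrite -Rintegral_setU//.
- by apply: Rintegral_subset => //; exact: measurableU.
- by apply: (@integrableS _ _ R lebesgue_measure) i2 => //; exact: measurableU.
- apply/disj_setPS => x [] /=; rewrite !in_itv/= => /andP[_ x1] /andP[x2 _].
  by have := lt_le_trans x1 (le_trans g2 (ltW x2)); rewrite ltxx.
Qed.

(** * Bound on the quadratic form [Q] by the scaled jumps *)

Lemma half_jump_le (R : realType) (p : nat) (D : 'I_p.+1 -> R) (x : R) :
  `|x| <= 1 -> `|(half_jump_poly D).[x]| <= 2^-1 * \sum_(k < p.+1) `|D k|.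
Proof.
move=> x1; rewrite half_jump_polyE /half_jump normrM.
rewrite (ger0_norm (_ : 0 <= 2^-1)) ?invr_ge0// ler_wpM2l ?invr_ge0//.
rewrite (le_trans (ler_norm_sum _ _ _))//; apply: ler_sum => k _.
rewrite normrM normrX normf_div [`|_%:R|]ger0_norm//.
rewrite -[leRHS]mulr1 ler_pM ?exprn_ile1//.
by rewrite ler_pdivrMr ?ltr0n ?fact_gt0// ler_peMr// ler1n fact_gt0.
Qed.

(** The competitor v = 0 turns the objective into two integrals of [G * G], and [half_jump_le]
    bounds |G| by S/2 on both half intervals. *)
Lemma sqrtQ_le (R : realType) (p : nat) (D : 'I_p.+1 -> R) :
  Num.sqrt (Q D) <= \sum_(k < p.+1) `|D k|.
Proof.
set S := \sum_(k < p.+1) _; have S0 : 0 <= S by apply: sumr_ge0.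
rewrite -[leRHS](ger0_norm S0) -sqrtr_sqr ler_wsqrtr//.
have [_ _ [_ /(_ 0)]] := Q_attained D; rewrite size_poly0 => /(_ isT).
move=> /le_trans; apply.
rewrite QobjE add0r sub0r mulrNN.
set G := half_jump_poly D.
(* A deliberately loose bound: S^2/4 is enlarged to S^2/2 and the length 1/2 to 1, so that the two
   halves add up to exactly S^2. *)
have I_le c d : c <= d -> d - c <= 1 -> (forall x, x \in `]c, d[ -> `|x| <= 1) ->
    integ_poly c d (G * G) <= 2^-1 * S ^+ 2.
  move=> cd dc1 x1.
  have ic : lebesgue_measure.-integrable `]c, d[ (EFin \o cst (2^-1 * S ^+ 2)).
    have := integrable_horner c d (2^-1 * S ^+ 2)%:P.
    by rewrite hornerC_ext.
  apply: (@le_trans _ _ (\int[lebesgue_measure]_(x in `]c, d[) (2^-1 * S ^+ 2))).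
    apply: le_Rintegral => //; first exact: integrable_horner.
    move=> x /= xcd; rewrite hornerM -expr2 -real_normK ?num_real//.
    apply: (@le_trans _ _ ((2^-1 * S) ^+ 2)).
      by rewrite lerXn2r ?nnegrE ?mulr_ge0 ?invr_ge0//; exact/half_jump_le/x1.
    by rewrite exprMn ler_wpM2r ?sqr_ge0//; lra.
  rewrite Rintegral_cst//= lebesgue_measure_itv/= lte_fin.
  rewrite -[leRHS]mulr1 ler_wpM2l ?mulr_ge0 ?invr_ge0 ?sqr_ge0//.
  by case: ifP.
have E : S ^+ 2 = 2^-1 * S ^+ 2 + 2^-1 * S ^+ 2 by lra.
rewrite E lerD// I_le//; try lra.
- by move=> x; rewrite in_itv/= => /andP[? ?]; rewrite ler_norml; lra.
- by move=> x; rewrite in_itv/= => /andP[? ?]; rewrite ler_norml; lra.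
Qed.

(** * Repeated integration by parts against polynomials, and one-sided derivatives *)

Lemma Rintegral_FTC (R : realType) (x y : R) (f F : R -> R) : x < y ->
  smooth f -> (forall z, is_derive z (1 : R) F (f z)) ->
  \int[lebesgue_measure]_(z in `[x, y]) f z = F y - F x.
Proof.
move=> xy sf dF.
have cF : continuous F.
  by move=> z; apply/differentiable_continuous/derivable1_diffP; have [] := dF z.
rewrite /Rintegral (@continuous_FTC2 _ f F)//.
- by apply: continuous_subspaceT; exact: smooth_continuous.
- split.
  + by move=> z _; have [] := dF z.
  + exact/cvg_at_right_filter/cF.
  + exact/cvg_at_left_filter/cF.
- by move=> z _; rewrite derive1E; apply: derive_val.
Qed.

(** The boundary terms produced by n integrations by parts in the integral of [v] times the n-th
    derivative of [f]. *)
Definition parts (R : realType) (f : R -> R) (n : nat) (v : {poly R}) (x : R) : R :=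
  \sum_(k < n) (-1) ^+ k * v^`(k).[x] * derive1n (n.-1 - k) f x.

Lemma partsS (R : realType) (f : R -> R) (n : nat) (v : {poly R}) (x : R) :
  parts f n.+1 v x = v.[x] * derive1n n f x - parts f n v^`() x.
Proof.
rewrite /parts big_ord_recl/= expr0 mul1r subn0; congr (_ + _).
rewrite -sumrN; apply: eq_bigr => k _; rewrite /bump leq0n add1n exprS.
rewrite -derivnS derivSn !mulN1r !mulNr; congr (- (_ * derive1n _ f x)).
by rewrite subnS; case: n k => [[]|n k] //=; rewrite -subn1 -subnDA addn1 subSS.
Qed.

(** Telescoping through [partsS]: the product v' f^(n) from the product rule cancels against the
    leading term of the induction hypothesis for v'. *)
Lemma is_derive_parts (R : realType) (f : R -> R) (n : nat) (v : {poly R}) (x : R) :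
  smooth f ->
  is_derive x (1 : R) (parts f n v)
    (v.[x] * derive1n n f x - (-1) ^+ n * v^`(n).[x] * f x).
Proof.
move=> sf; elim: n v => [|n IH] v.
  rewrite (_ : parts f 0 v = cst 0);
    last by apply/funext => z; rewrite /parts big_ord0.
  by rewrite derivn0 expr0 mul1r subrr; exact: is_derive_cst.
rewrite (_ : parts f n.+1 v = fun z => v.[z] * derive1n n f z - parts f n v^`() z);
  last by apply/funext => z; exact: partsS.
have df : is_derive x (1 : R) (derive1n n f) (derive1n n.+1 f x).
  by rewrite derive1nS derive1E; apply: DeriveDef => //.
apply: is_derive_eq (is_deriveB (is_deriveM (is_derive_poly v x) df) (IH v^`())) _.
rewrite /GRing.scale /= -derivSn exprS; ring.
Qed.

(** The degree of [v] is below n, so its n-th derivative vanishes and [parts] is an exact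
    antiderivative. *)
Lemma Rintegral_parts (R : realType) (f : R -> R) (n : nat) (v : {poly R})
    (x y : R) :
  x < y -> smooth f -> (size v <= n)%N ->
  \int[lebesgue_measure]_(z in `[x, y]) (v.[z] * derive1n n f z) =
  parts f n v y - parts f n v x.
Proof.
move=> xy sf sv; apply: Rintegral_FTC => //.
  by apply: smoothM; [exact: smooth_horner|exact: smooth_derive1n].
move=> z; have := is_derive_parts n v z sf.
by rewrite (derivn_poly0 sv) horner0 mulr0 mul0r subr0.
Qed.

(** Just to the right of x the derivatives of [w] are those of [v], which are continuous at x; the
    limit never sees the value of [w] at x. *)
Lemma Mval_poly (R : realType) (w : R -> R) (v : {poly R}) (x y : R) (k : nat) :
  x < y -> (forall z, z \in `]x, y[ -> w z = v.[z]) ->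
  Mval w x k = v^`(k).[x].
Proof.
move=> xy wv; apply: cvg_lim => //.
have := cvg_at_right_filter (@continuous_horner R v^`(k) x).
have E z : z \in `]x, y[ -> v^`(k).[z] = derive1n k w z.
  move=> zI; rewrite -derive1n_horner; apply/esym.
  apply: (@derive1n_eq_open R w (horner v) `]x, y[%classic) => //.
  - by move=> t; rewrite inE/= => /wv.
  - by rewrite inE.
apply: cvg_trans; apply: near_eq_cvg; near=> z.
by apply: E; rewrite in_itv/=; apply/andP.
Unshelve. all: by end_near. Qed.

Lemma Lval_poly (R : realType) (w : R -> R) (v : {poly R}) (x y : R) (k : nat) :
  y < x -> (forall z, z \in `]y, x[ -> w z = v.[z]) ->
  Lval w x k = v^`(k).[x].
Proof.
move=> yx wv; apply: cvg_lim => //.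
have := cvg_at_left_filter (@continuous_horner R v^`(k) x).
have E z : z \in `]y, x[ -> v^`(k).[z] = derive1n k w z.
  move=> zI; rewrite -derive1n_horner; apply/esym.
  apply: (@derive1n_eq_open R w (horner v) `]y, x[%classic) => //.
  - by move=> t; rewrite inE/= => /wv.
  - by rewrite inE.
apply: cvg_trans; apply: near_eq_cvg; near=> z.
by apply: E; rewrite in_itv/=; apply/andP.
Unshelve. all: by end_near. Qed.

(** * Integrals of products with a bounded smooth factor *)

Lemma smooth_integrable (R : realType) (f : R -> R) (x y : R) :
  smooth f -> lebesgue_measure.-integrable `[x, y] (EFin \o f).
Proof.
move=> sf; apply: continuous_compact_integrable; first exact: segment_compact.
by apply: continuous_subspaceT; exact: smooth_continuous.
Qed.

Lemma integrableM_smooth (R : realType) (A : set R) (f g : R -> R) (K : R) :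
  measurable A -> lebesgue_measure.-integrable A (EFin \o f) ->
  smooth g -> (forall x, `|g x| <= K) ->
  lebesgue_measure.-integrable A (EFin \o (fun x => f x * g x)).
Proof.
move=> mA fi sg gK.
apply: (@integrableMl _ _ R lebesgue_measure A mA (EFin \o f) g fi).
  apply: (@measurable_funS _ _ _ _ setT) => //.
  by apply: measurable_realfun.continuous_measurable_fun; exact: smooth_continuous.
exists K; split; first exact: num_real.
by move=> M KM x _; apply: (le_trans (gK x)); exact: ltW.
Qed.

(** The localized duality estimate, meant for a test function or its derivative as [g]: its support
    confines the integral to [A], where its sup norm is factored out. *)
Lemma Rintegral_mul_le (R : realType) (A B : set R) (f g : R -> R) (K : R) :
  measurable A -> measurable B -> A `<=` B ->
  lebesgue_measure.-integrable B (EFin \o f) ->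
  smooth g -> (forall x, `|g x| <= K) -> (forall x, ~ A x -> g x = 0) ->
  `|\int[lebesgue_measure]_(x in B) (f x * g x)| <=
  K * \int[lebesgue_measure]_(x in A) `|f x|.
Proof.
move=> mA mB AB fi sg gK g0.
rewrite (Rintegral_support AB) => [|x _ /g0 ->]; last by rewrite mulr0.
have fA := @integrableS _ _ R lebesgue_measure _ _ _ mB mA AB fi.
have fgi := integrableM_smooth mA fA sg gK.
rewrite (le_trans (@le_normr_Rintegral _ _ R lebesgue_measure _ _ mA fgi))//.
rewrite -RintegralZl//; last exact: integrable_norm.
apply: le_Rintegral => //; first exact: integrable_norm.
  have := @integrableZl _ _ R lebesgue_measure A mA K _ (integrable_norm fA).
  by apply: eq_integrable.
by move=> x _; rewrite normrM mulrC ler_wpM2r.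
Qed.

(** * Test functions rescaled to a neighbourhood of a node *)

Section scaled_test_function.
Variables (R : realType) (psi : R -> R) (c h : R).
Hypotheses (h0 : 0 < h) (spsi : smooth psi).
Hypothesis psi0 : forall x, x \notin `[- 4^-1, 4^-1] -> psi x = 0.

Let phi x := psi ((x - c) / h).

Let sphi : smooth phi. Proof. exact: smooth_affine. Qed.

Lemma scaled_out x : x \notin `[c - h / 4, c + h / 4] ->
  (x - c) / h \notin `[- 4^-1, 4^-1].
Proof.
rewrite !in_itv/= ler_pdivlMr// ler_pdivrMr// => /negP xI; apply/negP => /andP[? ?].
by apply: xI; apply/andP; split; lra.
Qed.

Lemma scaled_eq0 n x : x \notin `[c - h / 4, c + h / 4] -> derive1n n phi x = 0.
Proof.
move=> xI; rewrite derive1n_affine//.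
by rewrite (derive1n_eq0 n psi0) ?mulr0//; exact: scaled_out.
Qed.

Lemma scaled_test_fun (a b : R) : a <= c - h -> c + h <= b -> test_fun a b phi.
Proof.
move=> ac cb.
have sub : closure [set x | phi x != 0] `<=` `[c - h / 4, c + h / 4].
  rewrite [X in _ `<=` X](closure_id _).1; last exact: itv_closed.
  by apply: closureS => x /=; apply: contra_neqT => xI; exact: (scaled_eq0 0).
split=> //.
- apply: (subclosed_compact _ (@segment_compact R _ _) sub).
  exact: closed_closure.
- apply: (subset_trans sub) => x /=; rewrite !in_itv/= => /andP[? ?].
  have := h0; move: ac cb; clear sphi; move=> ? ? ?; apply/andP; split; lra.
Qed.

Lemma parts_scaled_eq0 n v x : x \notin `[c - h / 4, c + h / 4] ->
  parts phi n v x = 0.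
Proof. by move=> xI; rewrite /parts big1// => k _; rewrite scaled_eq0// mulr0. Qed.

Lemma Rintegral_scaled (a b : R) (w : R -> R) (n : nat) (L M : {poly R}) :
  a <= c - h -> c + h <= b ->
  lebesgue_measure.-integrable `]a, b[ (EFin \o w) ->
  (size L <= n)%N -> (size M <= n)%N ->
  (forall x, x \in `]c - h, c[ -> w x = L.[x]) ->
  (forall x, x \in `]c, c + h[ -> w x = M.[x]) ->
  \int[lebesgue_measure]_(x in `]a, b[) (w x * derive1n n phi x) =
  parts phi n L c - parts phi n M c.
Proof.
move=> ac cb wi sL sM wL wM.
have hh := h0.
have sd := @smooth_derive1n R _ n sphi.
(* The interval is wider than the support of [phi], so that its endpoints carry no boundary
   terms. *)
have d0 x : ~ `[c - h / 2, c + h / 2]%classic x -> derive1n n phi x = 0.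
  move=> /= xI; apply: scaled_eq0; apply/negP => xJ; apply: xI.
  by move: xJ; rewrite !in_itv/= => /andP[? ?]; apply/andP; split; lra.
have sub : `[c - h / 2, c + h / 2] `<=` `]a, b[.
  by move=> x /=; rewrite !in_itv/= => /andP[? ?]; apply/andP; split; lra.
rewrite (Rintegral_support sub) => [|x _ /d0 ->]; last by rewrite mulr0.
have [K K0 HK] : exists2 K, 0 < K & forall x, `|derive1n n phi x| <= K.
  have [K K0 HK] := smooth_bounded (@smooth_derive1n R _ n spsi)
    (fun x => @derive1n_eq0 R 4^-1 psi n x psi0).
  exists (h ^- n * K) => [|x]; first by rewrite mulr_gt0// invr_gt0 exprn_gt0.
  rewrite /phi derive1n_affine// normrM ger0_norm ?ler_wpM2l//;
    by rewrite invr_ge0 exprn_ge0// ltW.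
have wdi : lebesgue_measure.-integrable `[c - h / 2, c + h / 2]
    (EFin \o (fun x => w x * derive1n n phi x)).
  apply: (integrableM_smooth _ _ sd HK) => //.
  exact: (@integrableS _ _ R lebesgue_measure _ _ _ _ _ sub).
have E : `[c - h / 2, c + h / 2]%classic =
    `[c - h / 2, c[ `|` `[c, c + h / 2] :> set R.
  apply: itv_bndbnd_setU; rewrite bnd_simp; lra.
move: wdi; rewrite E => wdi; rewrite Rintegral_setU//; last first.
  apply/disj_setPS => x [] /=; rewrite !in_itv/= => /andP[_ x1] /andP[x2 _].
  by have := lt_le_trans x1 x2; rewrite ltxx.
have vi (v : {poly R}) (x y : R) : lebesgue_measure.-integrable `[x, y]
    (EFin \o (fun x => v.[x] * derive1n n phi x)).
  apply: smooth_integrable; apply: smoothM => //; exact: smooth_horner.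
have -> : \int[lebesgue_measure]_(x in `[c - h / 2, c[) (w x * derive1n n phi x) =
    parts phi n L c.
  transitivity (\int[lebesgue_measure]_(x in `[c - h / 2, c[)
    (L.[x] * derive1n n phi x)).
    apply: eq_Rintegral => x; rewrite inE/= in_itv/= => /andP[? ?].
    by rewrite wL// in_itv/=; apply/andP; split; lra.
  rewrite Rintegral_itv_bndo_bndc; last first.
    apply: (@integrableS _ _ R lebesgue_measure `[c - h / 2, c]) => //.
    exact: subset_itv_co_cc.
  rewrite Rintegral_parts//; last lra.
  rewrite (@parts_scaled_eq0 n L (c - h / 2)) ?subr0//.
  by rewrite in_itv/=; apply/negP => /andP[? ?]; lra.
have -> : \int[lebesgue_measure]_(x in `[c, c + h / 2]) (w x * derive1n n phi x) =
    - parts phi n M c.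
  (* The point c is removed because [w] is unconstrained there; it is restored once [w] has been
     replaced by [M]. *)
  rewrite -Rintegral_itv_obnd_cbnd; last first.
    apply: (@integrableS _ _ R lebesgue_measure _ _ _ _ _ _ wdi) => //.
      exact: measurableU.
    by move=> x; right; exact: subset_itv_oc_cc.
  transitivity (\int[lebesgue_measure]_(x in `]c, c + h / 2])
    (M.[x] * derive1n n phi x)).
    apply: eq_Rintegral => x; rewrite inE/= in_itv/= => /andP[? ?].
    by rewrite wM// in_itv/=; apply/andP; split; lra.
  rewrite Rintegral_itv_obnd_cbnd; last first.
    apply: (@integrableS _ _ R lebesgue_measure `[c, c + h / 2]) => //.
    exact: subset_itv_oc_cc.
  rewrite Rintegral_parts//; last lra.
  rewrite (@parts_scaled_eq0 n M (c + h / 2)) ?sub0r//.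
  by rewrite in_itv/=; apply/negP => /andP[? ?]; lra.
by [].
Qed.

(** The k-th summand of [parts] involves the derivative of [psi] of order p - k at 0, so the
    prescribed jet keeps k = m alone; the power of h comes from the rescaling. *)
Lemma parts_jet (p m : nat) (v : {poly R}) : (m <= p)%N ->
  (forall j, (j < p.+1)%N -> derive1n j psi 0 = (j == p - m)%N%:R) ->
  parts phi p.+1 v c = (-1) ^+ m * v^`(m).[c] * h ^- (p - m).
Proof.
move=> mp psij; rewrite /parts (bigD1 (inord m))//= big1 ?addr0 => [|k km].
  rewrite inordK// derive1n_affine// subrr mul0r psij; last by rewrite ltnS leq_subr.
  by rewrite eqxx mulr1.
rewrite derive1n_affine// subrr mul0r psij; last by rewrite ltnS leq_subr.
(* Truncated subtraction is injective here: p - k = p - m forces k = m since both are at most p. *)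
rewrite (_ : (_ == _) = false) ?mulr0//; apply/negP => /eqP E.
move/negP: km; apply; apply/eqP/val_inj; rewrite /= inordK//.
by rewrite -(subKn mp) -E subKn// -ltnS ltn_ord.
Qed.

End scaled_test_function.

(** * Local jump estimate and summation over the nodes *)

(** The profile [psi] depends on p and m only and is fixed before the interval, the mesh and the
    functions; this makes [K] uniform in all of them. *)
Lemma jump_bound (R : realType) (p : nat) (m : 'I_p.+1) :
  exists2 K : R, 0 < K &
  forall (a b c h : R) (u g w : R -> R) (L M : {poly R}),
    0 < h -> a <= c - h -> c + h <= b ->
    lebesgue_measure.-integrable `]a, b[ (EFin \o u) ->
    is_weak_deriv a b p.+1 u g ->
    lebesgue_measure.-integrable `]a, b[ (EFin \o w) ->
    (size L <= p.+1)%N -> (size M <= p.+1)%N ->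
    (forall x, x \in `]c - h, c[ -> w x = L.[x]) ->
    (forall x, x \in `]c, c + h[ -> w x = M.[x]) ->
    h ^+ p.+1 * (h * `|scaled_jump p h w c m|) <=
    K * (\int[lebesgue_measure]_(x in `]c - h / 2, c - h / 2 + h[) `|u x - w x| +
      h ^+ p.+1 *
        \int[lebesgue_measure]_(x in `]c - h / 2, c - h / 2 + h[) `|g x|).
Proof.
have r0 : 0 < (4^-1 : R) by rewrite invr_gt0.
have [psi [spsi psi0 psij]] :=
  @smooth_jet R 4^-1 (fun j => (j == p - m)%N%:R) p.+1 r0.
have [K1 K10 HK1] := smooth_bounded (@smooth_derive1n R _ p.+1 spsi)
  (fun x => @derive1n_eq0 R 4^-1 psi p.+1 x psi0).
have [K2 K20 HK2] := smooth_bounded spsi psi0.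
(* [K1] bounds the derivative of [psi] of order p+1, which meets u - w; [K2] bounds [psi], which
   meets the weak derivative. *)
exists (K1 + K2) => [|a b c h u g w L M h0 ac cb ui [gi wd] wi sL sM wL wM].
  exact: addr_gt0.
set I := `]_, _[%classic.
have mp : (m <= p)%N by rewrite -ltnS.
pose phi x := psi ((x - c) / h).
have sphi : smooth phi by exact: smooth_affine.
have sd := @smooth_derive1n R _ p.+1 sphi.
have hp : 0 < h ^+ p.+1 by exact: exprn_gt0.
have HK1' x : `|derive1n p.+1 phi x| <= h ^- p.+1 * K1.
  by rewrite /phi derive1n_affine// normrM ger0_norm ?ler_wpM2l// invr_ge0 ltW.
have HK2' x : `|phi x| <= K2 by exact: HK2.
have phi0 n x : ~ I x -> derive1n n phi x = 0.
  rewrite /I/= => xI; apply: scaled_eq0 => //; apply/negP => xJ; apply: xI.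
  by move: xJ; rewrite !in_itv/= => /andP[? ?]; apply/andP; split; lra.
have sub : I `<=` `]a, b[.
  by move=> x; rewrite /I/= !in_itv/= => /andP[? ?]; apply/andP; split; lra.
have mI : measurable I by exact: measurable_itv.
have mab : measurable `]a, b[%classic by exact: measurable_itv.
have uwi : lebesgue_measure.-integrable `]a, b[ (EFin \o (fun x => u x - w x)).
  have := @integrableB _ _ R lebesgue_measure _ mab _ _ ui wi.
  by apply: eq_integrable.
(* Multiplying by h turns the scaling h^-(p+1-m) into h^-(p-m), the power given by [parts_jet].
   Signs disappear in the absolute value. *)
have jumpE : h * `|scaled_jump p h w c m| =
    `|\int[lebesgue_measure]_(x in `]a, b[) (w x * derive1n p.+1 phi x)|.
  rewrite (Rintegral_scaled h0 spsi psi0 ac cb wi sL sM wL wM).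
  rewrite !(@parts_jet R psi c h spsi p m)// -mulrBl -mulrBr.
  rewrite !normrM normrX normrN1 expr1n mul1r.
  rewrite /scaled_jump /jump (Mval_poly _ _ wM) ?ltrDl// (Lval_poly _ _ wL) ?gtrBl//.
  rewrite distrC subSn// [`|h ^- (_ - _).+1|]gtr0_norm ?invr_gt0 ?exprn_gt0//.
  rewrite [`|h ^- _|]gtr0_norm ?invr_gt0 ?exprn_gt0//.
  by rewrite exprS invfM mulrCA mulVKf ?gt_eqF.
(* Write w = u - (u - w) and move the derivatives from [phi] to u by the definition of the weak
   derivative. *)
have split_int : \int[lebesgue_measure]_(x in `]a, b[) (w x * derive1n p.+1 phi x) =
    (-1) ^+ p.+1 * \int[lebesgue_measure]_(x in `]a, b[) (g x * phi x) -
    \int[lebesgue_measure]_(x in `]a, b[) ((u x - w x) * derive1n p.+1 phi x).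
  rewrite -wd; last exact: scaled_test_fun.
  rewrite -RintegralB//.
  - by apply: eq_Rintegral => x _; ring.
  - exact: (integrableM_smooth mab ui sd HK1').
  - exact: (integrableM_smooth mab uwi sd HK1').
have b1 := Rintegral_mul_le mI mab sub uwi sd HK1' (phi0 p.+1).
have b2 := Rintegral_mul_le mI mab sub gi sphi HK2' (phi0 0%N).
set X := \int[lebesgue_measure]_(x in I) `|u x - w x|.
set Y := \int[lebesgue_measure]_(x in I) `|g x|.
rewrite -/X in b1; rewrite -/Y in b2.
have X0 : 0 <= X by apply: Rintegral_ge0.
have Y0 : 0 <= Y by apply: Rintegral_ge0.
have J : h * `|scaled_jump p h w c m| <= h ^- p.+1 * K1 * X + K2 * Y.
  rewrite jumpE split_int (le_trans (ler_normB _ _))// addrC lerD//.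
  by rewrite normrM normrX normrN1 expr1n mul1r.
apply: le_trans (ler_wpM2l (ltW hp) J) _.
rewrite mulrDr !mulrA divff ?gt_eqF// mul1r.
(* These two nonnegative cross terms are the whole slack in replacing [K1] and [K2] by their sum. *)
have := mulr_ge0 (ltW K20) X0; have := mulr_ge0 (mulr_ge0 (ltW K10) (ltW hp)) Y0.
rewrite [in X in _ -> _ -> X](mulrC _ K2) !mulrDl !mulrDr !mulrA; lra.
Qed.

Lemma weak_derivP (R : realType) (a b : R) (m k : nat) (u : R -> R) :
  sobolevW1 a b m u -> (k <= m)%N -> is_weak_deriv a b k u (weak_deriv a b k u).
Proof. by move=> [_ H] /H; exact: xgetPex. Qed.

Theorem theorem2p4 (R : realType) (a b : R) (p : nat) (hab : a < b) :
  exists C1 C12 : R, [/\ 0 < C1, 0 < C12 &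
    forall (N : nat) (u uR : R -> R),
      (0 < N)%N ->
      sobolevW1 a b p.+1 u ->
      piecewise_poly a b N p uR ->
      let h := mesh a b N in
      h ^+ p.+1 *
        (C12 * (\sum_(1 <= i < N)
            h * Num.sqrt (Q (fun k : 'I_p.+1 =>
                  scaled_jump p h uR (node a b N i) k)))
         - C1 * sobolev_seminorm a b p.+1 u)
      <= LpNorm 1 a b (fun x => u x - uR x)].
Proof.
(* One constant for each jump order, collected by finite choice before the mesh and the functions
   are introduced. *)
have [K K0 HK] := fin_all_exists2 (@jump_bound R p).
pose S := \sum_m K m.
have S0 : 0 < S.
  by rewrite /S (bigD1 ord0)//= ltr_pwDl// sumr_ge0// => m _; rewrite ltW.
(* The summed local bounds carry the factor [S] on both the error and the seminorm; dividing by it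
   leaves coefficient 1 on the seminorm. *)
exists 1, S^-1; split=> //; first by rewrite invr_gt0.
move=> N u w N0 Su pw /=; set h := mesh a b N.
have ui : lebesgue_measure.-integrable `]a, b[ (EFin \o u) by case: Su.
have wi := piecewise_poly_integrable hab N0 pw.
have wd := weak_derivP Su (leqnn _).
rewrite /sobolev_seminorm !LpNorm1E mul1r.
set g := weak_deriv _ _ _ _ in wd *.
have gi : lebesgue_measure.-integrable `]a, b[ (EFin \o g) by case: wd.
have h0 : 0 < h by rewrite divr_gt0 ?subr_gt0// ltr0n.
have hp : 0 < h ^+ p.+1 by exact: exprn_gt0.
have nodeS i : node a b N i.+1 = node a b N i + h.
  by rewrite /node -/h -natr1 mulrDl mul1r addrA.
have node_ge i : a <= node a b N i.
  by have := le_node N hab (leq0n i); rewrite {1}/node mul0r addr0.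
have node_le i : (i <= N)%N -> node a b N i <= b.
  by move=> iN; rewrite -[leRHS](node_last a b N0) le_node.
pose I i := `]node a b N i - h / 2, node a b N i - h / 2 + h[%classic.
pose X i := \int[lebesgue_measure]_(x in I i) `|u x - w x|.
pose Y i := \int[lebesgue_measure]_(x in I i) `|g x|.
have loc i : (0 < i < N)%N ->
    h ^+ p.+1 * (h * Num.sqrt (Q (fun k : 'I_p.+1 =>
      scaled_jump p h w (node a b N i) k))) <= S * (X i + h ^+ p.+1 * Y i).
  move=> /andP[i0 iN].
  (* The cells meeting at node i have indices i-1 and i; [i.-1] is a true predecessor because i >
     0. *)
  have [L sL wL] := pw _ (leq_ltn_trans (leq_pred i) iN).
  have [M sM wM] := pw _ iN.
  have predE : node a b N i.-1 = node a b N i - h.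
    by rewrite -{2}(prednK i0) nodeS addrK.
  rewrite prednK// predE in wL; rewrite nodeS in wM.
  apply: (@le_trans _ _ (h ^+ p.+1 * (h * \sum_(k < p.+1)
      `|scaled_jump p h w (node a b N i) k|))).
    by rewrite ler_wpM2l ?(ltW hp)// ler_wpM2l ?(ltW h0)// sqrtQ_le.
  rewrite !mulr_sumr mulr_suml; apply: ler_sum => m _.
  apply: (HK m a b) ui wd wi sL sM wL wM => //.
    by rewrite -predE.
  by rewrite -nodeS node_le.
have uwi : lebesgue_measure.-integrable `]a, b[ (EFin \o (fun x => u x - w x)).
  have := @integrableB _ _ R lebesgue_measure _ (measurable_itv `]a, b[) _ _ ui wi.
  by apply: eq_integrable.
(* Nodes are h apart, so consecutive intervals [I i] abut without overlapping. *)
have tI i : (0 < i < N)%N -> [/\ a <= node a b N i - h / 2,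
    node a b N i - h / 2 + h <= node a b N i.+1 - h / 2 &
    node a b N i - h / 2 + h <= b].
  move=> /andP[i0 iN]; rewrite nodeS.
  have := node_ge i.-1; have := node_le _ iN; have := nodeS i.-1.
  by rewrite prednK// nodeS => ? ? ?; split; lra.
have sum_le f : lebesgue_measure.-integrable `]a, b[ (EFin \o f) ->
    \sum_(1 <= i < N) \int[lebesgue_measure]_(x in I i) `|f x| <=
    \int[lebesgue_measure]_(x in `]a, b[) `|f x|.
  move=> fi; apply: (sum_Rintegral_le (ltW h0)) => //.
  exact: (@integrable_norm _ _ R lebesgue_measure).
have tot := ler_sum_nat loc.
rewrite -!mulr_sumr big_split/= -mulr_sumr in tot.
set T := \sum_(1 <= i < N) _ in tot *.
(* Clearing the constant [S^-1] and the subtraction reduces the goal to the summed local bound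
   [tot]. *)
rewrite mulrBr mulrCA lerBlDr [S^-1 * _]mulrC ler_pdivrMr// [leRHS]mulrC.
rewrite -mulr_sumr -/T.
apply: le_trans tot _; rewrite ler_wpM2l ?(ltW S0)// lerD ?sum_le//.
by rewrite ler_wpM2l ?(ltW hp)// sum_le.
Qed.
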